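(* Let $\lambda=(N,\psi,O,R,\{e_i\})$ be an s-space over an $n$-dimensional manifold $M$ with base change morphism $L:O\to GL(n)$. Then the assignment $T\mapsto {}^{\lambda}T$ is a one-to-one correspondence between the tensor fields $T$ of type $(0,2)$ on $M$ and the differentiable maps $F:N\to\mathbb{R}^{n\times n}$ satisfying the invariance property $$F\circ R_a=(L(a))^{t}\,F\,L(a)\qquad\text{for all } a\in O .$$
   Context: All manifolds and maps are smooth; $M_p$ denotes the tangent space of $M$ at $p$. An s-space over an $n$-dimensional manifold $M$ is a collection $\lambda=(N,\psi,O,R,\{e_i\})$ where: (a) $N$ is a manifold; (b) $\psi:N\to M$ is a surjective submersion; (c) $O$ is a Lie group and $R$ is a right action of $O$ on $N$, written $R_a(z)=z.a$, with $\psi\circ R_a=\psi$ for all $a\in O$, and transitive on each fiber of $\psi$; (d) $e_i:N\to TM$, $1\le i\le n$, are differentiable functions such that $\{e_1(z),\dots,e_n(z)\}$ is a basis of $M_{\psi(z)}$ for all $z\in N$. All s-spaces are assumed to have rigid base change: there is a differentiable map $L:O\to GL(n)$ (the base change morphism, which is a group morphism) such that $e_i(z.a)=\sum_{l=1}^n e_l(z)L(a)^l_i$ for all $z\in N$, $a\in O$, $1\le i\le n$. For a $(0,2)$ tensor field $T$ on $M$, the matrix function ${}^{\lambda}T:N\to\mathbb{R}^{n\times n}$ is $[{}^{\lambda}T(z)]^i_j=T(\psi(z))(e_i(z),e_j(z))$. *)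

(* Defs.v *)
From HB Require Import structures.
From mathcomp Require Import all_boot all_order all_algebra.
From mathcomp Require Import all_classical all_reals all_analysis.

Set Implicit Arguments.
Unset Strict Implicit.
Unset Printing Implicit Defensive.
Import Order.TTheory GRing.Theory Num.Theory.
Import numFieldNormedType.Exports.
Local Open Scope classical_set_scope.
Local Open Scope ring_scope.

(* [D] is meant to be an open subset of a finite-dimensional space, where the
   clauses below amount to the existence and continuity on [D] of all partial
   derivatives of order at most [k]. *)
Fixpoint Ck_on (R : realType) (V W : normedModType R) (k : nat)
    (D : set V) (f : V -> W) : Prop :=
  if k is k'.+1 then
    (forall x, D x -> differentiable f x) /\
    (forall v : V, Ck_on k' D (fun x => 'D_v f x))
  else forall x, D x -> {for x, continuous f}.

Definition smooth_on (R : realType) (V W : normedModType R)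
    (D : set V) (f : V -> W) : Prop := forall k, Ck_on k D f.

(* [chart_inv] is only meaningful on [chart_map @` chart_dom]. *)
Record chart (R : realType) (n : nat) (X : topologicalType) := Chart {
  chart_dom : set X;
  chart_map :> X -> 'rV[R]_n;
  chart_inv : 'rV[R]_n -> X;
  chart_dom_open : open chart_dom;
  chart_image_open : open (chart_map @` chart_dom);
  chart_mapK : forall p, chart_dom p -> chart_inv (chart_map p) = p;
  chart_map_continuous :
    forall p, chart_dom p -> {for p, continuous chart_map};
  chart_inv_continuous :
    forall x, (chart_map @` chart_dom) x -> {for x, continuous chart_inv} }.

(* The atlas is a family of charts, not assumed maximal: none of the notions
   below changes when compatible charts are added. *)
Record manifold (R : realType) (n : nat) := Manifold {
  mcarrier :> topologicalType;
  mindex : Type;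
  mchart : mindex -> chart R n mcarrier;
  manifold_hausdorff : hausdorff_space mcarrier;
  manifold_second_countable : @second_countable mcarrier;
  mchart_cover : forall p, exists c, chart_dom (mchart c) p;
  mchart_compat : forall c d,
    smooth_on (mchart c @` (chart_dom (mchart c) `&` chart_dom (mchart d)))
              (mchart d \o chart_inv (mchart c)) }.

Section SmoothMaps.
Context {R : realType}.

Definition smooth_fun_on n (M : manifold R n) (W : normedModType R)
    (U : set M) (f : M -> W) : Prop :=
  forall c : mindex M,
    smooth_on (mchart c @` (chart_dom (mchart c) `&` U))
              (f \o chart_inv (mchart c)).

Definition smooth_fun n (M : manifold R n) (W : normedModType R)
    (f : M -> W) : Prop := smooth_fun_on setT f.

Definition smooth_map m n (N : manifold R m) (M : manifold R n)
    (f : N -> M) : Prop :=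
  continuous f /\
  forall (c : mindex N) (d : mindex M),
    smooth_on
      (mchart c @` (chart_dom (mchart c) `&` f @^-1` chart_dom (mchart d)))
      (mchart d \o f \o chart_inv (mchart c)).

(* Smoothness of [f : N1 * N2 -> M], the product manifold being covered by the
   product charts with values in ['rV_m1 * 'rV_m2]. *)
Definition smooth_map2 m1 m2 n (N1 : manifold R m1) (N2 : manifold R m2)
    (M : manifold R n) (f : N1 -> N2 -> M) : Prop :=
  continuous (fun z : N1 * N2 => f z.1 z.2) /\
  forall (c1 : mindex N1) (c2 : mindex N2) (d : mindex M),
    smooth_on
      [set x : 'rV[R]_m1 * 'rV[R]_m2 |
        [/\ (mchart c1 @` chart_dom (mchart c1)) x.1,
            (mchart c2 @` chart_dom (mchart c2)) x.2 &
            chart_dom (mchart d) (f (chart_inv (mchart c1) x.1)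
                                    (chart_inv (mchart c2) x.2))]]
      (fun x : 'rV[R]_m1 * 'rV[R]_m2 =>
        mchart d (f (chart_inv (mchart c1) x.1)
                    (chart_inv (mchart c2) x.2))).

End SmoothMaps.

Section Tangent.
Context {R : realType} {n : nat} (M : manifold R n).

Definition transition (c d : mindex M) : 'rV[R]_n -> 'rV[R]_n :=
  mchart d \o chart_inv (mchart c).

(* A tangent vector at [p] is given by its coordinates in all the charts
   around [p], related by the Jacobians of the transition maps; the value
   attached to a chart that does not contain [p] is the dummy [0]. *)
Definition is_tangent (p : M) (v : mindex M -> 'rV[R]_n) : Prop :=
  (forall c, ~ chart_dom (mchart c) p -> v c = 0) /\
  (forall c d, chart_dom (mchart c) p -> chart_dom (mchart d) p ->
     v d = 'd (transition c d) (mchart c p) (v c)).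

Definition tangent_pred (p : M) : {pred mindex M -> 'rV[R]_n} :=
  fun v => `[< is_tangent p v >].

Lemma tangent_submod_closed p : submod_closed (tangent_pred p).
Proof.
split=> [|a u v /asboolP[u0 uc] /asboolP[v0 vc]]; apply/asboolP.
  by split=> [//|c d _ _]; rewrite linear0.
split=> [c pc|c d pc pd].
  by rewrite /= [LHS](_ : _ = a *: u c + v c)// u0// v0// scaler0 addr0.
rewrite [LHS](_ : _ = a *: u d + v d)//.
by rewrite [X in 'd _ _ X](_ : _ = a *: u c + v c)// linearP -uc// -vc.
Qed.
HB.instance Definition _ p :=
  GRing.isSubmodClosed.Build R (mindex M -> 'rV[R]_n) (tangent_pred p)
    (tangent_submod_closed p).

Record tangent (p : M) := Tangent {
  tcoord :> mindex M -> 'rV[R]_n;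
  tcoordP : tcoord \in tangent_pred p }.

HB.instance Definition _ p := [isSub for @tcoord p].
HB.instance Definition _ p := [Choice of tangent p by <:].
HB.instance Definition _ p := [SubChoice_isSubLmodule of tangent p by <:].

Definition tangent_bundle := {p : M & tangent p}.


Lemma transitionE c d p : chart_dom (mchart c) p ->
  transition c d (mchart c p) = mchart d p.
Proof. by move=> pc; rewrite /transition /= chart_mapK. Qed.

Lemma differentiable_transition c d p :
  chart_dom (mchart c) p -> chart_dom (mchart d) p ->
  differentiable (transition c d) (mchart c p).
Proof.
by move=> pc pd; have [+ _] := mchart_compat c d 1; apply; exists p.
Qed.

Lemma diff_transition_comp c d e p u :
  chart_dom (mchart c) p -> chart_dom (mchart d) p ->
  chart_dom (mchart e) p ->
  'd (transition c e) (mchart c p) u =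
  'd (transition d e) (mchart d p) ('d (transition c d) (mchart c p) u).
Proof.
move=> pc pd pe.
have dcd := differentiable_transition pc pd.
have cdE := transitionE d pc.
have dde : differentiable (transition d e) (transition c d (mchart c p)).
  by rewrite cdE; exact: differentiable_transition.
have near_eq : \forall x \near mchart c p,
    transition c e x = (transition d e \o transition c d) x.
  have inv_dom : \forall x \near mchart c p,
      chart_dom (mchart d) (chart_inv (mchart c) x).
    have /chart_inv_continuous/= : (mchart c @` chart_dom (mchart c))
      (mchart c p) by exists p.
    apply; rewrite chart_mapK//; apply: open_nbhs_nbhs.
    by split=> //; exact: chart_dom_open.
  by near do rewrite /transition /= chart_mapK//.
have dce := differentiable_transition pc pe.
rewrite -[LHS](deriveE u dce) (near_eq_derive u near_eq).
rewrite (deriveE u (differentiable_comp dcd dde)).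
rewrite [LHS](congr1 (@^~ u) (diff_comp dcd dde)).
by rewrite [LHS]/= [in LHS]cdE.
Unshelve. all: by end_near. Qed.

Definition coord_vec_coord (c : mindex M) (u : 'rV[R]_n) (p : M) :
    mindex M -> 'rV[R]_n :=
  fun d => if `[< chart_dom (mchart c) p /\ chart_dom (mchart d) p >]
           then 'd (transition c d) (mchart c p) u else 0.

Lemma coord_vec_subproof c u p : coord_vec_coord c u p \in tangent_pred p.
Proof.
apply/asboolP; rewrite /coord_vec_coord; split=> [d npd|d e pd pe].
  by case: asboolP => // -[].
case: (pselect (chart_dom (mchart c) p)) => pc; last first.
  by rewrite !asboolF ?linear0// => -[].
by rewrite !asboolT//; exact: diff_transition_comp.
Qed.

(* The tangent vector at [p] with coordinates [u] in the chart [c], and [0] if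
   [c] does not contain [p]. *)
Definition coord_vec c u p : tangent p := Tangent (coord_vec_subproof c u p).

Definition coord_field (c : mindex M) (i : 'I_n) (p : M) : tangent p :=
  coord_vec c (delta_mx 0 i) p.

End Tangent.

Section Geometry.
Context {R : realType}.

(* [w] is the image of [v] under the differential of [f] at [z]. *)
Definition is_differential m n (N : manifold R m) (M : manifold R n)
    (f : N -> M) (z : N) (v : tangent z) (w : tangent (f z)) : Prop :=
  forall (c : mindex N) (d : mindex M),
    chart_dom (mchart c) z -> chart_dom (mchart d) (f z) ->
    w d = 'd (mchart d \o f \o chart_inv (mchart c)) (mchart c z) (v c).
Arguments is_differential {m n N M} f {z} v w.

Definition submersion m n (N : manifold R m) (M : manifold R n)
    (f : N -> M) : Prop :=
  smooth_map f /\
  forall (z : N) (w : tangent (f z)),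
    exists v : tangent z, is_differential f v w.

(* A map [N -> TM] over [f], given by its values [e z] in [M_(f z)]; its
   smoothness is read in the charts of [TM] induced by the charts of [M]. *)
Definition smooth_along m n (N : manifold R m) (M : manifold R n)
    (f : N -> M) (e : forall z : N, tangent (f z)) : Prop :=
  smooth_map f /\
  forall d : mindex M,
    smooth_fun_on (f @^-1` chart_dom (mchart d)) (fun z => e z d).

Definition is_basis n (V : lmodType R) (e : 'I_n -> V) : Prop :=
  (forall a : 'I_n -> R, \sum_i a i *: e i = 0 -> forall i, a i = 0) /\
  (forall v : V, exists a : 'I_n -> R, v = \sum_i a i *: e i).

Record lie_group (k : nat) := LieGroup {
  lie_manifold :> manifold R k;
  lie_mul : lie_manifold -> lie_manifold -> lie_manifold;
  lie_one : lie_manifold;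
  lie_inv : lie_manifold -> lie_manifold;
  lie_mulA : associative lie_mul;
  lie_mul1 : left_id lie_one lie_mul;
  lie_mulV : left_inverse lie_one lie_inv lie_mul;
  lie_mul_smooth : smooth_map2 lie_mul;
  lie_inv_smooth : smooth_map lie_inv }.

Record s_space (n : nat) (M : manifold R n) := SSpace {
  ss_dim : nat;
  ss_N : manifold R ss_dim;
  ss_psi : ss_N -> M;
  ss_Odim : nat;
  ss_O : lie_group ss_Odim;
  ss_act : ss_N -> ss_O -> ss_N;
  ss_e : 'I_n -> forall z : ss_N, tangent (ss_psi z);
  ss_psi_surj : forall p : M, exists z : ss_N, ss_psi z = p;
  ss_psi_submersion : submersion ss_psi;
  ss_act_smooth : smooth_map2 ss_act;
  ss_act1 : forall z, ss_act z (lie_one ss_O) = z;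
  ss_actM : forall z a b, ss_act z (lie_mul a b) = ss_act (ss_act z a) b;
  ss_psi_act : forall z a, ss_psi (ss_act z a) = ss_psi z;
  ss_act_trans : forall z z', ss_psi z = ss_psi z' ->
    exists a : ss_O, z' = ss_act z a;
  ss_e_smooth : forall i, smooth_along (ss_e i);
  ss_e_basis : forall z, is_basis (fun i => ss_e i z) }.

Definition ss_R n (M : manifold R n) (lam : s_space M) (a : ss_O lam) :
    ss_N lam -> ss_N lam := fun z => ss_act z a.

(* [L] is valued in the matrices; [L a \in unitmx] makes it a map into [GL(n)],
   an open submanifold of the matrices. The last clause is an equality in
   [TM], since both sides live in fibers over provably equal base points. *)
Definition base_change_morphism n (M : manifold R n) (lam : s_space M)
    (L : ss_O lam -> 'M[R]_n) : Prop :=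
  [/\ forall a, L a \in unitmx,
      forall a b, L (lie_mul a b) = L a *m L b,
      smooth_fun L &
      forall z a i,
        existT _ (ss_psi (ss_act z a)) (ss_e i (ss_act z a)) =
        existT _ (ss_psi z) (\sum_l L a l i *: ss_e l z)
        :> tangent_bundle M].

Definition tensor_field02 n (M : manifold R n) :
    set (forall p : M, tangent p -> tangent p -> R) :=
  [set T |
    [/\ forall p (u : tangent p), scalar (T p u),
        forall p (w : tangent p), scalar (fun u => T p u w) &
        forall (c : mindex M) (i j : 'I_n),
          smooth_fun_on (W := R^o) (chart_dom (mchart c))
            (fun p => T p (coord_field c i p) (coord_field c j p))]].

Definition frame_matrix n (M : manifold R n) (lam : s_space M)
    (T : forall p : M, tangent p -> tangent p -> R) (z : ss_N lam) : 'M[R]_n :=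
  \matrix_(i, j) T (ss_psi z) (ss_e i z) (ss_e j z).

End Geometry.

Arguments ss_R {R n M} lam a z.
Arguments tensor_field02 {R n} M.
Arguments frame_matrix {R n M} lam T z.
Arguments base_change_morphism {R n M} lam L.

(* Main.v *)
From HB Require Import structures.
Require Import Defs.
From mathcomp Require Import all_boot all_order all_algebra.
From mathcomp Require Import all_classical all_reals all_analysis.
From mathcomp Require Import lra.
Import Order.TTheory GRing.Theory Num.Theory.
Import numFieldNormedType.Exports.
Local Open Scope classical_set_scope.
Local Open Scope ring_scope.
Set Implicit Arguments.
Unset Strict Implicit.
Unset Printing Implicit Defensive.

(* Over a point z of N, the frame e_i(z) identifies a bilinear form on
   M_(psi z) with the matrix of its values on the frame. The matrix function of
   a tensor field is smooth because it is E G E^T, where E is the matrix of the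
   coordinates of the frame and G the Gram matrix of the coordinate fields of a
   chart. Conversely, a matrix function F with the invariance property defines a
   form on each M_p that does not depend on the point z chosen in the fiber of
   p, because O is transitive on the fibers. Its components in a chart, composed
   with psi, are the entries of E^-1 F E^-T, hence smooth on N. They are smooth
   on M because psi has differentiable local sections s with
   ds_q = P (dpsi_(s q) P)^-1, where P is a right inverse of dpsi at one point:
   for h smooth on N, every directional derivative of h o s is h' o s with h'
   smooth, so h o s is C^k for all k by induction on k. *)

(** * Functions of class C^k *)

Section Differentiability.
Context {R : realType} {V W : normedModType R}.
Implicit Types (f g : V -> W) (x : V).

(** The little-o expansion determines the differential ([diff_unique]), so an explicit candidate [l]
    can be certified by a plain estimate. This is how the differential of a local inverse is found
    below. *)
Lemma is_diff_epsP f x (l : {linear V -> W}) : continuous l ->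
  (forall e : R, 0 < e ->
    \forall h \near 0, `|f (h + x) - f x - l h| <= e * `|h|) ->
  is_diff x f l.
Proof.
move=> lc fl; have E : f \o shift x = cst (f x) + l +o_ 0 id.
  apply/eqaddoP => e e0; near=> h.
  have -> : (f \o shift x - (cst (f x) + l)) h = f (h + x) - f x - l h.
    by rewrite opprD addrA.
  by near: h; exact: fl.
have dE := diff_unique lc E.
apply: DiffDef => //; apply/diff_locallyP; rewrite dE; split => //.
Unshelve. all: by end_near. Qed.

Lemma differentiable_eps f x (e : R) : differentiable f x -> 0 < e ->
  \forall h \near 0, `|f (h + x) - f x - 'd f x h| <= e * `|h|.
Proof.
move=> /diff_locally /eqaddoP H e0; near=> h.
have <- : (f \o shift x - (cst (f x) + 'd f x)) h
  = f (h + x) - f x - 'd f x h by rewrite !fctE /= opprD addrA.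
by near: h; exact: H.
Unshelve. all: by end_near. Qed.

Lemma near_eq_differentiable f g x :
  (\forall y \near x, f y = g y) -> differentiable f x -> differentiable g x.
Proof.
move=> fg df.
suff : is_diff x g ('d f x) by move=> [].
apply: is_diff_epsP => [|e e0]; first exact: diff_continuous.
near=> h; rewrite -(nbhs_singleton fg).
rewrite -(_ : f (h + x) = g (h + x)).
  by near: h; exact: differentiable_eps.
near: h; have := fg; rewrite (near_shift 0 x) subr0; apply: filterS => h /=.
Unshelve. all: by end_near. Qed.

End Differentiability.

Section CkOn.
Context {R : realType} {V : normedModType R}.
Implicit Types (D E : set V) (k : nat).

Section General.
Context {W : normedModType R}.
Implicit Types f g : V -> W.

Lemma Ck_on_subset k D E f : D `<=` E -> Ck_on k E f -> Ck_on k D f.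
Proof.
move=> DE; elim: k f => [|k IH] f /= => [H x /DE/H//|[df dvf]].
by split=> [x /DE/df//|v]; exact: IH.
Qed.

Lemma Ck_onW k D f : Ck_on k.+1 D f -> Ck_on k D f.
Proof.
elim: k f => [|k IH] f [df dvf].
  by move=> x Dx; exact/differentiable_continuous/df.
by split => // v; exact: IH.
Qed.

(** Openness turns agreement on [D] into agreement near each of its points, so iterated derivatives
    agree on [D] too. Derivatives can then be replaced by formulas valid on [D] only. *)
Lemma Ck_on_eq k D f g : open D -> (forall x, D x -> f x = g x) ->
  Ck_on k D f -> Ck_on k D g.
Proof.
move=> oD; have nearE h h' : (forall x, D x -> h x = h' x) ->
    forall x, D x -> \forall y \near x, (h y : W) = h' y.
  move=> hh' x Dx; near=> y; apply: hh'; near: y.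
  exact: open_nbhs_nbhs.
elim: k f g => [|k IH] f g fg /=.
  move=> cf x Dx; rewrite /prop_for/continuous_at -(fg _ Dx).
  by apply: (cvg_trans _ (cf x Dx)); apply/near_eq_cvg/nearE.
move=> [df dvf]; split=> [x Dx|v].
  by apply: (near_eq_differentiable _ (df x Dx)); exact: nearE.
apply: IH (dvf v) => x Dx.
by apply: near_eq_derive; exact: nearE.
Unshelve. all: by end_near. Qed.

(** Derivatives are taken in the ambient space, and the set only says at which points: the pieces
    [E] need not be open. *)
Lemma Ck_on_local k D f :
  (forall x, D x -> exists2 E, E x & Ck_on k E f) -> Ck_on k D f.
Proof.
elim: k f => [|k IH] f H /=; first by move=> x /H[E Ex]; apply.
split=> [x /H[E Ex [+ _]]|v]; first exact.
by apply: IH => x /H[E Ex [_ /(_ v)]]; exists E.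
Qed.

Lemma Ck_on_cst k D (a : W) : Ck_on k D (cst a).
Proof.
elim: k a => [|k IH] a /=; first by move=> x _; exact: cst_continuous.
split=> [x _|v]; first exact: differentiable_cst.
rewrite (_ : (fun _ => _) = cst 0)//.
by apply/funext => x; rewrite derive_cst.
Qed.

Lemma Ck_on_add k D f g : open D ->
  Ck_on k D f -> Ck_on k D g -> Ck_on k D (fun x => f x + g x).
Proof.
move=> oD; elim: k f g => [|k IH] f g /=.
  by move=> cf cg x Dx; apply: continuousD; [exact: cf|exact: cg].
move=> [df dvf] [dg dvg]; split=> [x Dx|v].
  by apply: differentiableD; [exact: df|exact: dg].
apply: (Ck_on_eq oD _ (IH _ _ (dvf v) (dvg v))) => x Dx.
by rewrite -deriveD//; apply: diff_derivable; [exact: df|exact: dg].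
Qed.

End General.

Lemma Ck_on_linear (W W' : normedModType R) k D (f : V -> W)
    (l : {linear W -> W'}) : open D -> continuous l ->
  Ck_on k D f -> Ck_on k D (l \o f).
Proof.
move=> oD lc; elim: k f => [|k IH] f.
  by move=> /= cf x Dx; apply: continuous_comp; [exact: cf|exact: lc].
move=> [df dvf]; have dl y : differentiable l y by exact: linear_differentiable.
split=> [x Dx|v]; first by apply: differentiable_comp => //; exact: df.
apply: (Ck_on_eq oD _ (IH _ (dvf v))) => x Dx.
rewrite [RHS]deriveE; last by apply: differentiable_comp => //; exact: df.
by rewrite diff_comp//= ?diff_lin ?deriveE//; exact: df.
Qed.

Lemma Ck_on_mul k D (f g : V -> R) : open D ->
  Ck_on k D f -> Ck_on k D g -> Ck_on k D (fun x => f x * g x).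
Proof.
move=> oD; elim: k f g => [|k IH] f g.
  by move=> cf cg x Dx; exact: (continuousM (cf _ Dx) (cg _ Dx)).
move=> cf cg; have [df dvf] := cf; have [dg dvg] := cg; split=> [x Dx|v].
  by exact: (differentiableM (df _ Dx) (dg _ Dx)).
apply: (@Ck_on_eq _ _ _ (fun x => f x * 'D_v g x + g x * 'D_v f x)) => //.
  move=> x Dx; rewrite -[RHS]/('D_v (f * g) x) deriveM//.
    exact/diff_derivable/df.
  exact/diff_derivable/dg.
apply: Ck_on_add => //; [exact: (IH _ _ (Ck_onW cf) (dvg v))|].
exact: (IH _ _ (Ck_onW cg) (dvf v)).
Qed.

Lemma Ck_on_inv k D (f : V -> R) : open D -> (forall x, D x -> f x != 0) ->
  Ck_on k D f -> Ck_on k D (fun x => (f x)^-1).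
Proof.
move=> oD f0; elim: k => [|k IH].
  by move=> cf x Dx; exact: (continuousV (f0 _ Dx) (cf _ Dx)).
move=> cf; have [df dvf] := cf; split=> [x Dx|v].
  by exact: (differentiableV (df _ Dx) (f0 _ Dx)).
have cV := IH (Ck_onW cf).
(* The derivative of the inverse is expressed through the inverse itself, to which the induction
   hypothesis [cV] applies. *)
apply: (@Ck_on_eq _ _ _
  (fun x => - 1 * ((f x)^-1 * (f x)^-1 * 'D_v f x))) => //.
  move=> x Dx; rewrite [RHS]deriveV; [|exact: f0|exact/diff_derivable/df].
  by rewrite mulN1r -invfM -expr2 scaleNr.
apply: Ck_on_mul => //; first exact: Ck_on_cst.
exact: (Ck_on_mul oD (Ck_on_mul oD cV cV) (dvf v)).
Qed.

Lemma Ck_on_sum (W : normedModType R) (I : Type) (r : seq I) (P : pred I)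
    (F : I -> V -> W) k D : open D -> (forall i, P i -> Ck_on k D (F i)) ->
  Ck_on k D (fun x => \sum_(i <- r | P i) F i x).
Proof.
move=> oD CF; elim: r => [|i r IH].
  rewrite (_ : (fun _ => _) = cst 0); first exact: Ck_on_cst.
  by apply/funext => x; rewrite big_nil.
case Pi : (P i).
  rewrite (_ : (fun _ => _) = (fun x => F i x + \sum_(i <- r | P i) F i x)).
    by apply: Ck_on_add => //; exact: CF.
  by apply/funext => x; rewrite big_cons Pi.
rewrite (_ : (fun _ => _) = (fun x => \sum_(i <- r | P i) F i x))//.
by apply/funext => x; rewrite big_cons Pi.
Qed.

Lemma Ck_on_prod (I : Type) (r : seq I) (P : pred I)
    (F : I -> V -> R) k D : open D -> (forall i, P i -> Ck_on k D (F i)) ->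
  Ck_on k D (fun x => \prod_(i <- r | P i) F i x).
Proof.
move=> oD CF; elim: r => [|i r IH].
  rewrite (_ : (fun _ => _) = cst 1); first exact: Ck_on_cst.
  by apply/funext => x; rewrite big_nil.
case Pi : (P i).
  rewrite (_ : (fun _ => _) = (fun x => F i x * \prod_(i <- r | P i) F i x)).
    by apply: Ck_on_mul => //; exact: CF.
  by apply/funext => x; rewrite big_cons Pi.
rewrite (_ : (fun _ => _) = (fun x => \prod_(i <- r | P i) F i x))//.
by apply/funext => x; rewrite big_cons Pi.
Qed.

(** Both directions compose with continuous linear maps: the coordinate forms, and
    [a |-> a *: delta_mx i j]. *)
Lemma Ck_on_mxP k D p q (F : V -> 'M[R]_(p, q)) : open D ->
  Ck_on k D F <-> (forall i j, Ck_on k D (fun x => F x i j)).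
Proof.
move=> oD; split=> [CF i j|CF].
  have cl : linear (fun N : 'M[R]_(p, q) => N i j : R).
    by move=> a u v; rewrite !mxE.
  pose l : {linear 'M[R]_(p, q) -> R} :=
    HB.pack (fun N : 'M[R]_(p, q) => N i j : R)
      (GRing.isLinear.Build _ _ _ _ _ cl).
  by apply: (@Ck_on_linear _ _ _ _ _ l) => //; exact: coord_continuous.
rewrite (_ : F = fun x => \sum_i \sum_j F x i j *: delta_mx i j); last first.
  by apply/funext => x; rewrite [LHS]matrix_sum_delta.
do 2! (apply: Ck_on_sum => // ? _).
set e := delta_mx _ _.
have cl : linear (fun a : R => a *: e).
  by move=> a u v; rewrite scalerDl scalerA.
pose l : {linear R -> 'M[R]_(p, q)} :=
  HB.pack (fun a : R => a *: e) (GRing.isLinear.Build _ _ _ _ _ cl).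
by apply: (@Ck_on_linear _ _ _ _ _ l) => //; exact: scalel_continuous.
Qed.

End CkOn.

(** * Smooth maps: matrix operations and composition *)

Section SmoothOn.
Context {R : realType}.
Implicit Types V W : normedModType R.

Lemma smooth_on_subset V W (D E : set V) (f : V -> W) :
  D `<=` E -> smooth_on E f -> smooth_on D f.
Proof. by move=> DE Ef k; apply: Ck_on_subset (Ef k). Qed.

Lemma smooth_on_eq V W (D : set V) (f g : V -> W) :
  open D -> (forall x, D x -> f x = g x) -> smooth_on D f -> smooth_on D g.
Proof. by move=> oD fg Df k; apply: Ck_on_eq (Df k). Qed.

Lemma smooth_on_local V W (D : set V) (f : V -> W) :
  (forall x, D x -> exists2 E, E x & smooth_on E f) -> smooth_on D f.
Proof.
by move=> H k; apply: Ck_on_local => x /H[E Ex Ef]; exists E => //; exact: Ef.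
Qed.

Lemma smooth_on_differentiable V W (D : set V) (f : V -> W) x :
  smooth_on D f -> D x -> differentiable f x.
Proof. by move=> /(_ 1)[df _] /df. Qed.

Lemma smooth_on_derive V W (D : set V) (f : V -> W) v :
  smooth_on D f -> smooth_on D ('D_v f).
Proof. by move=> Df k; have [_] := Df k.+1; exact. Qed.

Lemma smooth_on_mxP V (D : set V) p q (F : V -> 'M[R]_(p, q)) : open D ->
  smooth_on D F <-> (forall i j, smooth_on D (fun x => F x i j)).
Proof.
move=> oD; split=> [DF i j k|DF k].
  by have /Ck_on_mxP := DF k; exact.
by apply/Ck_on_mxP => // i j; exact: DF.
Qed.

Lemma smooth_on_mulmx V (D : set V) p q r (F : V -> 'M[R]_(p, q))
    (G : V -> 'M[R]_(q, r)) : open D ->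
  smooth_on D F -> smooth_on D G -> smooth_on D (fun x => F x *m G x).
Proof.
move=> oD DF DG; apply/smooth_on_mxP => // i j k.
rewrite (_ : (fun _ => _) = fun x => \sum_l F x i l * G x l j); last first.
  by apply/funext => x; rewrite mxE.
have cF := (Ck_on_mxP k F oD).1 (DF k); have cG := (Ck_on_mxP k G oD).1 (DG k).
by apply: Ck_on_sum => // l _; apply: Ck_on_mul.
Qed.

Lemma smooth_on_trmx V (D : set V) p q (F : V -> 'M[R]_(p, q)) : open D ->
  smooth_on D F -> smooth_on D (fun x => (F x)^T).
Proof.
move=> oD DF; have cF := (smooth_on_mxP F oD).1 DF.
apply/smooth_on_mxP => // i j.
rewrite (_ : (fun _ => _) = fun x => F x j i); first exact: cF.
by apply/funext => x; rewrite mxE.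
Qed.

Lemma smooth_on_cst V W (D : set V) (a : W) : smooth_on D (cst a).
Proof. by move=> k; exact: Ck_on_cst. Qed.

Lemma smooth_on_det V (D : set V) p (F : V -> 'M[R]_p) : open D ->
  smooth_on D F -> smooth_on D (fun x => \det (F x)).
Proof.
move=> oD DF k; have cF := (smooth_on_mxP F oD).1 DF.
apply: Ck_on_sum => // s _.
apply: Ck_on_mul => //; first exact: Ck_on_cst.
by apply: Ck_on_prod => // i _; exact: cF.
Qed.

Lemma smooth_on_invmx V (D : set V) p (F : V -> 'M[R]_p) : open D ->
  (forall x, D x -> F x \in unitmx) ->
  smooth_on D F -> smooth_on D (fun x => invmx (F x)).
Proof.
move=> oD uF DF; apply/smooth_on_mxP => // i j k.
(* Cramer's rule: each entry of the inverse is a cofactor divided by the determinant. *)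
apply: (@Ck_on_eq _ _ _ _ _ (fun x => (\det (F x))^-1 *
   ((-1) ^+ (j + i) * \det (row' j (col' i (F x)))))) => //.
  by move=> x Dx; rewrite /invmx uF// !mxE.
apply: Ck_on_mul => //.
  apply: Ck_on_inv => // [x /uF|]; first by rewrite unitmxE unitfE.
  exact: smooth_on_det.
apply: Ck_on_mul => //; first exact: Ck_on_cst.
apply: smooth_on_det => //; apply/smooth_on_mxP => // i' j'.
rewrite (_ : (fun _ => _) = fun x => F x (lift j i') (lift i j')).
  exact: (smooth_on_mxP F oD).1.
by apply/funext => x; rewrite !mxE.
Qed.

Lemma diff_rV m W (f : 'rV[R]_m -> W) x u :
  'd f x u = \sum_i u 0 i *: 'd f x (delta_mx 0 i).
Proof.
rewrite {1}(row_sum_delta u) linear_sum; apply: eq_bigr => i _.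
exact: linearZ.
Qed.

Lemma derive_comp_rV V m (f : V -> 'rV[R]_m) (g : 'rV[R]_m -> R) x v :
  differentiable f x -> differentiable g (f x) ->
  'D_v (g \o f) x = \sum_i ('D_v f x) 0 i * 'D_(delta_mx 0 i) g (f x).
Proof.
move=> df dg; rewrite deriveE; last exact: differentiable_comp.
rewrite diff_comp//= diff_rV; apply: eq_bigr => i _.
by rewrite !deriveE.
Qed.

(** Induction on [k] with [g] generalised: by the chain rule, a derivative of [g \o f] is a sum of
    products of derivatives of [f] with partial derivatives of [g] composed with [f], and these
    partial derivatives are again smooth. *)
Lemma smooth_on_comp V m (D : set V) (E : set 'rV[R]_m) (f : V -> 'rV[R]_m)
    (g : 'rV[R]_m -> R) : open D -> (forall x, D x -> E (f x)) ->
  smooth_on D f -> smooth_on E g -> smooth_on D (g \o f).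
Proof.
move=> oD DE Df Eg k; elim: k g Eg => [|k IH] g Eg.
  move=> x Dx; apply: differentiable_continuous.
  apply: differentiable_comp; first exact: (smooth_on_differentiable Df).
  exact: (smooth_on_differentiable Eg (DE _ Dx)).
split=> [x Dx|v].
  apply: differentiable_comp; first exact: (smooth_on_differentiable Df).
  exact: (smooth_on_differentiable Eg (DE _ Dx)).
apply: (@Ck_on_eq _ _ _ _ _
  (fun x => \sum_i ('D_v f x) 0 i * ('D_(delta_mx 0 i) g \o f) x)) => //.
  move=> x Dx; rewrite derive_comp_rV//.
    exact: (smooth_on_differentiable Df).
  exact: (smooth_on_differentiable Eg (DE _ Dx)).
apply: Ck_on_sum => // i _; apply: Ck_on_mul => //.
  exact: (smooth_on_mxP _ oD).1 (smooth_on_derive v Df) 0 i k.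
exact/IH/smooth_on_derive.
Qed.

Lemma smooth_on_jacobian m n (D : set 'rV[R]_m) (f : 'rV[R]_m -> 'rV[R]_n) :
  open D -> smooth_on D f -> smooth_on D (jacobian f).
Proof.
move=> oD Df; apply/smooth_on_mxP => // i j.
apply: (@smooth_on_eq _ _ _ (fun x => ('D_(delta_mx 0 i) f x) 0 j)) => //.
  move=> x Dx; rewrite mxE deriveE//.
  exact: (smooth_on_differentiable Df).
exact: (smooth_on_mxP _ oD).1 (smooth_on_derive (delta_mx 0 i) Df) 0 j.
Qed.

End SmoothOn.

(** * Local sections of submersions *)

(** Makes matrices available as a complete normed module, for [banach_fixed_point]. *)
HB.instance Definition _ (R : realType) p q := Complete.on 'M[R]_(p, q).

Section LocalSection.
Context {R : realType}.

Lemma mx_norm_le p q (A : 'M[R]_(p, q)) (C : R) : 0 <= C ->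
  (forall i j, `|A i j| <= C) -> `|A| <= C.
Proof.
by move=> C0 AC; rewrite /Num.Def.normr/= mx_normrE bigmax_le.
Qed.

Lemma mx_norm_coord p q (A : 'M[R]_(p, q)) i j : `|A i j| <= `|A|.
Proof.
rewrite [leRHS]/Num.Def.normr/= mx_normrE.
exact: (le_bigmax _ (fun ij : 'I_p * 'I_q => `|A ij.1 ij.2|) (i, j)).
Qed.

Lemma norm_mulmx_le r p q (A : 'M[R]_(r, p)) (B : 'M[R]_(p, q)) :
  `|A *m B| <= p%:R * `|A| * `|B|.
Proof.
apply: mx_norm_le => [|i j]; first by rewrite !mulr_ge0.
rewrite mxE (le_trans (ler_norm_sum _ _ _))//.
rewrite (_ : _ * _ = \sum_(l < p) `|A| * `|B|); last first.
  by rewrite sumr_const card_ord -mulrA mulr_natl.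
apply: ler_sum => l _; rewrite normrM ler_pM//; exact: mx_norm_coord.
Qed.

Lemma continuous_mulmxr r p q (B : 'M[R]_(p, q)) :
  continuous (fun A : 'M[R]_(r, p) => A *m B).
Proof.
apply: (@bounded_linear_continuous _ _ _ (mulmxr B)).
apply/linear_boundedP; exists (p%:R * `|B|); split=> // s /ltW Bs A.
by rewrite (le_trans (norm_mulmx_le A B))// mulrAC ler_wpM2r.
Qed.

Lemma continuous_mulmx r p q (A : 'M[R]_(r, p)) :
  continuous (fun B : 'M[R]_(p, q) => A *m B).
Proof.
apply: (@bounded_linear_continuous _ _ _ (mulmx A)).
apply/linear_boundedP; exists (p%:R * `|A|); split=> // s /ltW As B.
by rewrite (le_trans (norm_mulmx_le A B))// ler_wpM2r.
Qed.

(** The norm of a row is the maximum over its coordinates, so the scalar mean value theorem along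
    the segment, applied to each coordinate, loses no constant. *)
Lemma mean_value_rV (V : normedModType R) p (f : V -> 'rV[R]_p) y v (C : R) :
  (forall t : R, 0 <= t <= 1 -> differentiable f (y + t *: v)) ->
  (forall t : R, 0 <= t <= 1 -> `|'d f (y + t *: v) v| <= C) ->
  `|f (y + v) - f y| <= C.
Proof.
move=> df fC; have C0 : 0 <= C.
  by apply: le_trans (fC 0 _) => //; rewrite lexx ler01.
apply: mx_norm_le => // i j; rewrite ord1 {i} !mxE.
pose g (t : R) : R := f (y + t *: v) 0 j.
have line t : is_diff t (fun t : R => y + t *: v) (fun h : R => h *: v).
  by apply: is_diff_eq; apply/funext => h /=; rewrite add0r.
have dg (t : R) : 0 <= t <= 1 ->
    is_derive t (1 : R) g ('d f (y + t *: v) v 0 j).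
  move=> t01; have dft := df _ t01.
  have dfl : differentiable (fun t : R => f (y + t *: v)) t.
    by apply: (@differentiable_comp _ _ _ _ (fun t : R => y + t *: v) f).
  have dft1 : derivable (fun t : R => f (y + t *: v)) t 1.
    exact: diff_derivable.
  apply: DeriveDef; first by move/derivable_mxP : dft1; exact.
  have -> : 'd f (y + t *: v) v = 'D_1 (fun t : R => f (y + t *: v)) t.
    rewrite deriveE// (@diff_comp _ _ _ _ (fun t : R => y + t *: v) f)//=.
    by rewrite diff_val scale1r.
  by rewrite derive_mx// mxE.
have [|t||t t01] := @MVT_segment _ g (fun t => 'd f (y + t *: v) v 0 j) 0 1.
- exact: ler01.
- by rewrite in_itv/= => /andP[t0 t1]; apply: dg; rewrite !ltW.
- apply: derivable_within_continuous => t; rewrite in_itv/= => t01.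
  by have [] := dg _ t01.
rewrite /g !scale1r scale0r addr0 subr0 mulr1 => ->.
apply: le_trans (mx_norm_coord _ _ _) (fC _ _).
by move: t01; rewrite in_itv.
Qed.


(** An inverse function theorem on the affine slice [x0 + y *m P]: there the derivative of [f] is
    [P *m jacobian f x], which is the identity at [x0]. The section is the local inverse followed by
    the parametrisation of the slice. *)
Lemma local_section m n (f : 'rV[R]_m -> 'rV[R]_n) (D : set 'rV[R]_m) x0
    (P : 'M[R]_(n, m)) : open D -> D x0 ->
  (forall x, D x -> differentiable f x) ->
  {for x0, continuous (jacobian f)} -> P *m jacobian f x0 = 1%:M ->
  exists (V : set 'rV[R]_n) (s : 'rV[R]_n -> 'rV[R]_m),
    [/\ open V, V (f x0) & forall q, V q ->
      [/\ D (s q), f (s q) = q, P *m jacobian f (s q) \in unitmx &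
        is_diff q s (fun w => w *m invmx (P *m jacobian f (s q)) *m P)]].
Proof.
move=> oD Dx0 df cJ PJ.
pose A x := P *m jacobian f x.
(* Chosen so that [n%:R * e <= 2^-1], the factor [n] coming from [norm_mulmx_le]; [n.+1] keeps [e]
   positive when [n = 0]. *)
pose e : R := (2 * n.+1%:R)^-1.
have e0 : 0 < e by rewrite invr_gt0 mulr_gt0.
have ne : n%:R * e <= 2^-1.
  by rewrite /e invfM mulrCA ler_piMr// ler_pdivrMr// mul1r ler_nat.
have nearA : \forall x \near x0, D x /\ `|A x - 1%:M| <= e.
  apply: filterI; first exact: open_nbhs_nbhs.
  have cA : {for x0, continuous A}.
    by apply: continuous_comp cJ _; exact: continuous_mulmx.
  have /cvgrPdist_le/(_ _ e0) := cA.
  by apply: filterS => x; rewrite [A x0]PJ distrC.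
pose g (y : 'rV[R]_n) := x0 + y *m P.
have [r r0 gr] : exists2 r : R, 0 < r &
    forall y, `|y| <= r -> D (g y) /\ `|A (g y) - 1%:M| <= e.
  have cg : g y @[y --> (0 : 'rV[R]_n)] --> x0.
    have gP : (y *m P) @[y --> (0 : 'rV[R]_n)] --> (0 : 'rV[R]_n) *m P.
      exact: continuous_mulmxr.
    rewrite -[x0 in _ --> x0]addr0 -(mul0mx _ P).
    exact: (cvgD (cvg_cst x0) gP).
  have : \forall y \near (0 : 'rV[R]_n), D (g y) /\ `|A (g y) - 1%:M| <= e.
    exact: cg nearA.
  (* Halving the radius passes from an open ball to a closed one. *)
  move=> /nbhs_norm0P[r /= r0 gr]; exists (r / 2); first by rewrite divr_gt0.
  move=> y yr; apply: gr => /=; rewrite (le_lt_trans yr)// gtr_pMr//.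
  by rewrite invf_lt1// ltr1n.
have contr (y u : 'rV[R]_n) : `|y| <= r -> `|u - u *m A (g y)| <= 2^-1 * `|u|.
  move=> /gr[_ Ae].
  rewrite -{1}[u]mulmx1 -mulmxBr (le_trans (norm_mulmx_le _ _))//.
  rewrite mulrAC ler_wpM2r//; apply: le_trans ne; rewrite ler_wpM2l//.
  by rewrite distrC.
(* A row [u] killed by [A (g y)] has norm at most half its own norm, hence vanishes. *)
have unitA y : `|y| <= r -> A (g y) \in unitmx.
  move=> yr; rewrite -row_free_unit; apply: inj_row_free => u uA0.
  have := contr y u yr; rewrite uA0 subr0 => u2.
  apply/eqP; rewrite -normr_le0 leNgt; apply/negP => u0.
  by move: u2; rewrite leNgt gtr_pMl// invf_lt1// ltr1n.
have dg (y : 'rV[R]_n) : is_diff y g (mulmxr P).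
  rewrite (_ : (mulmxr P : _ -> _) = 0 + mulmxr P); last by rewrite add0r.
  apply: is_diffD; apply: DiffDef.
    apply: (@linear_differentiable _ _ _ (mulmxr P)).
    exact: continuous_mulmxr.
  by rewrite (@diff_lin _ _ _ (mulmxr P))//; exact: continuous_mulmxr.
(* The deviation of [f \o g] from the identity; [contr] bounds its differential by 1/2, which gives
   [lip] through the mean value inequality. *)
pose h y := y - f (g y).
have dfg (z : 'rV[R]_n) : `|z| <= r -> is_diff z (f \o g) (mulmxr (A (g z))).
  move=> /gr[Dgz _]; have dfgz := df _ Dgz.
  apply: DiffDef; first exact: differentiable_comp.
  rewrite diff_comp// diff_val; apply/funext => v /=.
  by rewrite /A mulmxA mul_rV_lin1.
have dh (z : 'rV[R]_n) : `|z| <= r -> is_diff z h (fun v => v - v *m A (g z)).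
  by move=> /dfg dfgz; exact: (is_diffB (is_diff_id z) dfgz).
have lip y y' : `|y| <= r -> `|y'| <= r -> `|h y' - h y| <= 2^-1 * `|y' - y|.
  move=> yr y'r.
  have seg (t : R) : 0 <= t <= 1 -> `|y + t *: (y' - y)| <= r.
    move=> /andP[t0 t1].
    have -> : y + t *: (y' - y) = (1 - t) *: y + t *: y'.
      by rewrite scalerBl scale1r scalerBr addrA addrAC.
    have t10 : 0 <= 1 - t by rewrite subr_ge0.
    rewrite (le_trans (ler_normD _ _))// !normrZ !ger0_norm//.
    rewrite (le_trans (lerD (ler_wpM2l t10 yr) (ler_wpM2l t0 y'r)))//.
    by rewrite -mulrDl subrK mul1r.
  rewrite -[y' in h y'](subrK y) [_ - y + y]addrC.
  apply: mean_value_rV => t /seg tr; have := dh _ tr; first by move=> [].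
  by move=> [_ ->]; exact: contr.
(* Solving [f (g y) = q] amounts to finding a fixed point of [y + (q - f (g y))],
   a 1/2-contraction of the closed ball of radius [r]. *)
have solve (q : 'rV[R]_n) : exists y,
    `|q - f x0| <= r / 2 -> `|y| <= r /\ f (g y) = q.
  (* Outside the ball [0] is a dummy value; the conditional statement lets [choice] produce a total
     function [Y]. *)
  have [qr|_] := boolP (`|q - f x0| <= r / 2); last by exists 0.
  pose U := closed_ball_ (fun z : 'rV[R]_n => `|z|) 0 r.
  have UE z : U z = (`|z| <= r) by rewrite /U /closed_ball_ /= sub0r normrN.
  have hU : {homo (fun y => h y + q) : y / U y >-> U y}.
    move=> y; rewrite !UE => yr.
    have h0 : h 0 = - f x0 by rewrite /h /g mul0mx addr0 sub0r.
    (* Each of the two terms has norm at most [r / 2], so the ball is mapped into itself. *)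
    have -> : h y + q = (h y - h 0) + (q - f x0).
      by rewrite h0 opprK addrACA subrr addr0.
    rewrite (le_trans (ler_normD _ _))// [r in leRHS]splitr lerD//.
    rewrite (le_trans (lip _ _ _ yr))// ?normr0 ?(ltW r0)//.
    by rewrite subr0 mulrC ler_wpM2r// invr_ge0.
  have ctr : is_contraction (mkfun hU).
    exists (2^-1)%:nng; split => /=; first by rewrite invf_lt1// ltr1n.
    move=> [y y'] /= [Uy Uy']; rewrite opprD addrACA subrr addr0.
    by move: Uy Uy'; rewrite !UE => Uy Uy'; exact: lip.
  have [||y + yE] := banach_fixed_point ctr.
  - exact: closed_closed_ball_.
  - by exists 0; rewrite UE normr0 ltW.
  rewrite UE => yr; exists y => _; split => //.
  apply/esym/subr0_eq/(addrI y); rewrite addr0 [q - _]addrC addrA.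
  exact: esym yE.
have [Y YP] := choice solve.
have Ylip q q' : `|q - f x0| <= r / 2 -> `|q' - f x0| <= r / 2 ->
    `|Y q' - Y q| <= 2 * `|q' - q|.
  move=> /YP[yr fy] /YP[y'r fy'].
  have : `|Y q' - Y q| <= 2^-1 * `|Y q' - Y q| + `|q' - q|.
    rewrite -[X in `|X| <= _](_ : h (Y q') - h (Y q) + (q' - q) = _);
      last first.
      by rewrite /h fy fy' opprD opprK addrACA subrK addrK.
    by rewrite (le_trans (ler_normD _ _))// lerD2r lip.
  by move: `|Y q' - Y q| `|q' - q| => a b; lra.
have r20 : 0 < r / 2 by rewrite divr_gt0.
exists (ball (f x0) (r / 2)), (g \o Y); split.
- exact: ball_open.
- exact: ballxx.
move=> q qV.
have Vball q' : ball (f x0) (r / 2) q' -> `|q' - f x0| <= r / 2.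
  by rewrite -ball_normE /= distrC => /ltW.
have qr := Vball _ qV.
have [yr fy] := YP _ qr; have [Dy _] := gr _ yr; have uA := unitA _ yr.
split=> //.
have dY : is_diff q Y (mulmxr (invmx (A (g (Y q))))).
  apply: is_diff_epsP => [|eps eps0]; first exact: continuous_mulmxr.
  set B := invmx _; pose c := n%:R * `|B|; have c0 : 0 <= c by rewrite mulr_ge0.
  (* [d] is the precision required of the expansion of [f \o g]: the resulting error on [Y] is at
     most [c * d * (2 * |w|)], with [c] from the product by [B] and [2] from [Ylip]. Using [c + 1]
     keeps the divisor positive. *)
  have [d d0 dE] : exists2 d, 0 < d & eps = d * (2 * (c + 1)).
    exists (eps / (2 * (c + 1))); last first.
      by rewrite divfK// mulf_neq0// gt_eqF// ltr_wpDl.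
    by rewrite divr_gt0// mulr_gt0// ltr_wpDl.
  have [dfgq dfgE] := dfg _ yr.
  have /nbhs_norm0P[t /= t0 tP] := differentiable_eps dfgq d0.
  have small : \forall w \near (0 : 'rV[R]_n), `|w| < 2^-1 * t.
    by apply: nbhs0_lt; rewrite mulr_gt0// invr_gt0.
  near=> w.
  have wV : ball (f x0) (r / 2) (w + q).
    near: w; have : nbhs q (ball (f x0) (r / 2)).
      by apply: open_nbhs_nbhs; split => //; exact: ball_open.
    by rewrite -[nbhs q _]/(\forall z \near q, ball (f x0) (r / 2) z)
      (near_shift 0 q) subr0.
  have [y'r fy'] := YP _ (Vball _ wV).
  have := Ylip _ _ qr (Vball _ wV); rewrite addrK => k2.
  set k := Y (w + q) - Y q in k2 *.
  have /tP : `|k| < t.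
    by rewrite (le_lt_trans k2)// -ltr_pdivlMl//; near: w; exact: small.
  rewrite dfgE /= subrK fy fy' addrK => kd.
  (* Up to sign and the factor [B], the error on [Y] is the remainder of [f \o g] at [Y q] for the
     increment [k], since [f \o g] increases by exactly [w]. *)
  have -> : k - w *m B = - ((w - k *m A (g (Y q))) *m B).
    by rewrite mulmxBl -mulmxA mulmxV// mulmx1 opprB.
  rewrite normrN (le_trans (norm_mulmx_le _ _))// mulrAC -/c.
  have : c * `|w - k *m A (g (Y q))| <= c * (d * (2 * `|w|)).
    by rewrite ler_wpM2l// (le_trans kd)// ler_wpM2l// ltW.
  move=> /le_trans; apply; rewrite !mulrA ler_wpM2r//.
  by rewrite dE -mulrA mulrCA ler_pM2l// [c * 2]mulrC ler_pM2l// lerDl.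
apply: is_diff_eq.
by apply/funext => w.
Unshelve. all: by end_near. Qed.

End LocalSection.

(** * Descent of smoothness along a submersion *)

Section Descent.
Context {R : realType}.

Lemma open_unitmx (V : normedModType R) (D : set V) p (F : V -> 'M[R]_p) :
  open D -> smooth_on D F -> open (D `&` [set x | F x \in unitmx]).
Proof.
move=> oD DF; rewrite openE => x [Dx]; rewrite /= unitmxE unitfE => Fx.
apply: filterI; first by apply: open_nbhs_nbhs.
have cdet : \det (F y) @[y --> x] --> \det (F x).
  exact: (smooth_on_det oD DF 0%N x Dx).
have nz : nbhs (\det (F x)) [set a | a != 0].
  by apply: open_nbhs_nbhs; split => //; exact: open_neq.
have nx : \forall y \near x, F y \in unitmx.
  near=> y; rewrite unitmxE unitfE; near: y; exact: (cdet _ nz).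
exact: nx.
Unshelve. all: by end_near. Qed.

Lemma smooth_descent m n (f : 'rV[R]_m -> 'rV[R]_n) (D : set 'rV[R]_m) x0
    (g : 'rV[R]_n -> R) : open D -> D x0 -> smooth_on D f ->
  (forall w, exists v, 'd f x0 v = w) -> smooth_on D (g \o f) ->
  exists2 V : set 'rV[R]_n, V (f x0) & smooth_on V g.
Proof.
move=> oD Dx0 Df sub Dgf.
have [P PJ] : exists P, P *m jacobian f x0 = 1%:M.
  apply/row_fullP; rewrite -sub1mx; apply/row_subP => i.
  have [v vE] := sub (row i 1%:M); apply/submxP; exists v.
  by rewrite -vE /jacobian mul_rV_lin1.
pose A x := P *m jacobian f x.
have DJ := smooth_on_jacobian oD Df.
have DA : smooth_on D A by apply: smooth_on_mulmx => //; exact: smooth_on_cst.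
(* The domain is shrunk so that the inverse of [A x], which enters the derivatives of the section,
   is smooth. *)
pose D' := D `&` [set x | A x \in unitmx].
have oD' : open D' by exact: open_unitmx.
have D'D : D' `<=` D by move=> x [].
have D'x0 : D' x0 by split; rewrite /= ?/A ?PJ ?unitmx1.
have [||V [s [oV Vx0 Vs]]] := local_section oD' D'x0 _ _ PJ.
- by move=> x /D'D; exact: smooth_on_differentiable.
- exact: (DJ 0%N x0 Dx0).
exists V => // k.
(* The claim is generalised from [g \o f] to every smooth [h] because the induction on [k] replaces
   [h] by [hv]. *)
suff main (h : 'rV[R]_m -> R) : smooth_on D' h -> Ck_on k V (h \o s).
  have := main _ (smooth_on_subset D'D Dgf).
  by apply: Ck_on_eq => // q /Vs[_ fs _ _]; rewrite /= fs.
have dhs (h' : 'rV[R]_m -> R) : smooth_on D' h' ->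
    forall q, V q -> differentiable (h' \o s) q.
  move=> D'h q /Vs[Dsq _ _ [ds _]]; apply: differentiable_comp => //.
  exact: (smooth_on_differentiable D'h).
elim: k h => [|k IH] h D'h.
  by move=> q Vq; apply: differentiable_continuous; exact: dhs.
split=> [q Vq|v]; first exact: dhs.
(* The differential of [h] at [x] applied to [v *m invmx (A x) *m P], which for [x = s q] is the
   image of [v] under the differential of [s] at [q]. *)
pose hv (x : 'rV[R]_m) :=
  (v *m invmx (A x) *m P *m (\col_i 'D_(delta_mx 0 i) h x)) 0 0.
apply: (@Ck_on_eq _ _ _ _ _ (hv \o s)) => //.
  move=> q Vq; have [D'sq _ _ dsq] := Vs _ Vq.
  have dhq := smooth_on_differentiable D'h D'sq.
  have dhsE : 'D_v (h \o s) q = 'd h (s q) (v *m invmx (A (s q)) *m P).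
    have dsq' : differentiable s q by case: dsq.
    rewrite deriveE; last exact: dhs.
    by rewrite (diff_comp dsq' dhq)/= diff_val.
  rewrite [RHS]dhsE diff_rV [LHS]/= /hv mxE; apply: eq_bigr => i _.
  by rewrite [X in _ * X = _]mxE deriveE.
apply: IH.
suff /smooth_on_mxP : smooth_on D' (fun x =>
  v *m invmx (A x) *m P *m (\col_i 'D_(delta_mx 0 i) h x)) by apply.
have D'A := smooth_on_subset D'D DA.
repeat (apply: smooth_on_mulmx => //; try exact: smooth_on_cst).
- by apply: smooth_on_invmx => // x [].
- apply/smooth_on_mxP => // i j.
  rewrite (_ : (fun _ => _) = 'D_(delta_mx 0 i) h).
    exact: smooth_on_derive.
  by apply/funext => x; rewrite mxE.
Qed.

End Descent.

(** * Charts and tangent vectors *)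

(** Near a point of the set, membership can be tested by pulling back along [chart_inv], which is
    continuous on the open image of the chart. *)
Lemma open_chart_image (R : realType) n (X : topologicalType)
    (c : chart R n X) (U : set X) :
  open U -> open (c @` (chart_dom c `&` U)).
Proof.
move=> oU; rewrite openE => _ [p [cp Up] <-].
have cc : (c @` chart_dom c) (c p) by exists p.
have inv_cvg : chart_inv c y @[y --> c p] --> p.
  have := chart_inv_continuous cc.
  by rewrite /prop_for/continuous_at chart_mapK.
have np : nbhs p (chart_dom c `&` U).
  apply: open_nbhs_nbhs; split => //; apply: openI => //.
  exact: chart_dom_open.
have nc : \forall y \near c p, (c @` chart_dom c) y.
  by apply: open_nbhs_nbhs; split => //; exact: chart_image_open.
have ni : \forall y \near c p, (chart_dom c `&` U) (chart_inv c y).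
  exact: (inv_cvg _ np).
have : \forall y \near c p, (c @` (chart_dom c `&` U)) y.
  near=> y; have [q cq qy] : (c @` chart_dom c) y by near: y.
  have : (chart_dom c `&` U) (chart_inv c y) by near: y.
  by rewrite -qy chart_mapK// => cUq; exists q.
exact.
Unshelve. all: by end_near. Qed.

Lemma scalar_sumZ (R : realType) (V : lmodType R) (f : V -> R) (I : Type)
    (r : seq I) (a : I -> R) (v : I -> V) : scalar f ->
  f (\sum_(i <- r) a i *: v i) = \sum_(i <- r) a i * f (v i).
Proof.
move=> fl; have f0 : f 0 = 0.
  by have := fl 1 0 0; rewrite scaler0 addr0 mul1r -[X in X = _]addr0 => /addrI.
elim: r => [|i r IH]; first by rewrite !big_nil.
by rewrite !big_cons fl IH.
Qed.

(** Serves twice: with the frame at [z] as [v] for the invariance property, and with the coordinate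
    fields as [v] for smoothness. *)
Lemma gram_mulmx (R : realType) (V : lmodType R) (T : V -> V -> R) m n
    (A : 'M[R]_(m, n)) (u : 'I_m -> V) (v : 'I_n -> V) :
  (forall x, scalar (T x)) -> (forall y, scalar (T^~ y)) ->
  (forall i, u i = \sum_k A i k *: v k) ->
  \matrix_(i, j) T (u i) (u j) =
    A *m (\matrix_(k, l) T (v k) (v l)) *m A^T.
Proof.
move=> Tr Tl uE; apply/matrixP => i j; rewrite !mxE.
rewrite (uE j) (scalar_sumZ _ _ _ (Tr _)); apply: eq_bigr => l _.
rewrite !mxE mulrC; congr (_ * _).
rewrite (uE i) (scalar_sumZ _ _ _ (Tl (v l))).
by apply: eq_bigr => k _; rewrite mxE.
Qed.

Section Tangent.
Context {R : realType} {n : nat} {M : manifold R n}.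

Lemma tangent_eq (p : M) d (u v : tangent p) :
  chart_dom (mchart d) p -> u d = v d -> u = v.
Proof.
move=> dp uv; apply: val_inj; apply/funext => e /=.
have /asboolP[u0 uJ] := tcoordP u; have /asboolP[v0 vJ] := tcoordP v.
have [ep|nep] := pselect (chart_dom (mchart e) p); last first.
  by rewrite u0// v0.
by rewrite (uJ d e dp ep) (vJ d e dp ep) uv.
Qed.

Lemma tcoord_linear (p : M) d (I : Type) (r : seq I) (a : I -> R)
    (u : I -> tangent p) :
  (\sum_(i <- r) a i *: u i : tangent p) d = \sum_(i <- r) a i *: u i d.
Proof.
elim: r => [|i r IH]; first by rewrite !big_nil.
by rewrite !big_cons -IH.
Qed.

Lemma coord_vecE (c : mindex M) w p : chart_dom (mchart c) p ->
  coord_vec c w p c = w.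
Proof.
move=> cp; rewrite /= /coord_vec_coord asboolT// -deriveE; last first.
  exact: differentiable_transition.
(* [transition c c] is known to be the identity on the image of the chart; this image being open,
   the derivative is the identity too. *)
have : \forall x \near mchart c p, transition c c x = id x.
  have : nbhs (mchart c p) (mchart c @` chart_dom (mchart c)).
    apply: open_nbhs_nbhs; split; first exact: chart_image_open.
    by exists p.
  by apply: filterS => _ [q cq <-]; rewrite transitionE.
by move/near_eq_derive => ->; rewrite derive_id.
Qed.

End Tangent.

(** * Frames of an s-space *)

Section SSpace.
Context {R : realType} {n : nat} {M : manifold R n} (lam : s_space M).
Implicit Types (z : ss_N lam) (d : mindex M).

Definition frame_coord_mx d z : 'M[R]_n := \matrix_(i, l) ss_e i z d 0 l.

Lemma row_frame_coord_mx d z i : row i (frame_coord_mx d z) = ss_e i z d.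
Proof. by apply/rowP => l; rewrite !mxE. Qed.

Lemma tcoord_frame (a : 'rV[R]_n) d z :
  (\sum_i a 0 i *: ss_e i z : tangent (ss_psi z)) d = a *m frame_coord_mx d z.
Proof.
rewrite tcoord_linear mulmx_sum_row; apply: eq_bigr => i _.
by rewrite row_frame_coord_mx.
Qed.

Lemma frame_coord_mx_unit d z : chart_dom (mchart d) (ss_psi z) ->
  frame_coord_mx d z \in unitmx.
Proof.
move=> dz; rewrite -row_free_unit; apply: inj_row_free => a aE0.
have [free _] := ss_e_basis z; apply/rowP => i; rewrite mxE.
apply: (free (a 0)); apply: (tangent_eq dz).
by rewrite tcoord_frame aE0.
Qed.

(* [a] is the row of coordinates of [u] in the frame at [z]; the base point
   [p] of [u] is only propositionally equal to [ss_psi z], so the charts are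
   used to compare [u] with the frame. *)
Definition frame_coords z (p : M) (u : tangent p) (a : 'rV[R]_n) : Prop :=
  forall d, u d = a *m frame_coord_mx d z.

Lemma frame_coords_exists z p (u : tangent p) : ss_psi z = p ->
  exists a, frame_coords z u a.
Proof.
move=> zp; case: p / zp u => u.
have [_ /(_ u)[a ->]] := ss_e_basis z; exists (\row_i a i) => d.
rewrite -tcoord_frame; congr (tcoord _ d).
by apply: eq_bigr => i _; rewrite mxE.
Qed.

Lemma frame_coords_uniq z p (u : tangent p) a b : ss_psi z = p ->
  frame_coords z u a -> frame_coords z u b -> a = b.
Proof.
move=> zp ua ub; have [d dp] := mchart_cover p.
have E_unit : frame_coord_mx d z \in unitmx.
  by apply: frame_coord_mx_unit; rewrite zp.
by apply: (can_inj (mulmxK E_unit)); rewrite -ua -ub.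
Qed.

Lemma frame_coords_chart z (u : tangent (ss_psi z)) a d :
  chart_dom (mchart d) (ss_psi z) -> u d = a *m frame_coord_mx d z ->
  frame_coords z u a.
Proof.
move=> dz ud e; rewrite -tcoord_frame; congr (tcoord _ e).
by apply: (tangent_eq dz); rewrite tcoord_frame.
Qed.

Lemma frame_coords_frame z i : frame_coords z (ss_e i z) (delta_mx 0 i).
Proof. by move=> d; rewrite -rowE row_frame_coord_mx. Qed.

Lemma open_psi_preimage d : open (ss_psi (s := lam) @^-1` chart_dom (mchart d)).
Proof.
have [[cpsi _] _] := ss_psi_submersion lam.
by move/continuousP: cpsi; apply; exact: chart_dom_open.
Qed.

Lemma frame_coord_mx_smooth d :
  smooth_fun_on (ss_psi (s := lam) @^-1` chart_dom (mchart d))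
    (frame_coord_mx d).
Proof.
move=> c; set D := _ @` _.
have oD : open D by exact/open_chart_image/open_psi_preimage.
apply/smooth_on_mxP => // i j.
have [_ /(_ d c) es] := ss_e_smooth lam i.
apply: (smooth_on_eq oD _ ((smooth_on_mxP _ oD).1 es 0 j)) => x _.
by rewrite /= mxE.
Qed.

Section BaseChange.
Variables (L : ss_O lam -> 'M[R]_n) (hL : base_change_morphism lam L).

(** The type of coordinate families does not mention the base point, so the equality in
    [tangent_bundle] projects to one without transport. *)
Lemma base_change_coord a z i :
  (ss_e i (ss_act z a) : mindex M -> 'rV[R]_n) =
  (\sum_l L a l i *: ss_e l z : tangent (ss_psi z)).
Proof.
have [_ _ _ /(_ z a i) E] := hL.
exact: (congr1 (fun w : tangent_bundle M => tcoord (projT2 w)) E).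
Qed.

Lemma frame_coord_mx_act d a z :
  frame_coord_mx d (ss_act z a) = (L a)^T *m frame_coord_mx d z.
Proof.
apply/row_matrixP => i; rewrite row_frame_coord_mx base_change_coord row_mul.
rewrite -tcoord_frame; congr (tcoord _ d); apply: eq_bigr => l _.
by rewrite !mxE.
Qed.

End BaseChange.

End SSpace.

(** * Tensor fields and equivariant matrix functions *)

Section Correspondence.
Context {R : realType} {n : nat} {M : manifold R n} (lam : s_space M).
Variables (L : ss_O lam -> 'M[R]_n) (hL : base_change_morphism lam L).
Implicit Types (z : ss_N lam) (d : mindex M) (F : ss_N lam -> 'M[R]_n)
  (T : forall p : M, tangent p -> tangent p -> R).

Definition equivariant F : Prop := forall a : ss_O lam,
  F \o ss_R lam a = (fun z => (L a)^T *m F z *m L a).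

(** Compares values of [T] in the fibers over [ss_psi (ss_act z a)] and [ss_psi z], which are
    distinct types over provably equal points. *)
Lemma tensor_tcoord_eq T (p q : M) (u v : tangent p) (u' v' : tangent q) :
  p = q -> u = u' :> (mindex M -> _) -> v = v' :> (mindex M -> _) ->
  T p u v = T q u' v'.
Proof.
move=> pq; case: q / pq u' v' => u' v' uu' vv'.
by congr (T _ _ _); exact: val_inj.
Qed.

Lemma frame_matrix_equivariant T : tensor_field02 M T ->
  equivariant (frame_matrix lam T).
Proof.
move=> [Tr Tl _] a; apply/funext => z /=.
(* Prepares the shape [A *m G *m A^T] with [A = (L a)^T]. *)
rewrite -[X in _ = _ *m X]trmxK.
rewrite -(gram_mulmx (Tr (ss_psi z)) (Tl (ss_psi z))
  (u := fun i => \sum_l L a l i *: ss_e l z)); last first.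
  by move=> i; apply: eq_bigr => l _; rewrite mxE.
apply/matrixP => i j; rewrite !mxE; apply: tensor_tcoord_eq.
- exact: ss_psi_act.
- exact: base_change_coord.
- exact: base_change_coord.
Qed.

Definition gram_coord T d (p : M) : 'M[R]_n :=
  \matrix_(k, l) T p (coord_field d k p) (coord_field d l p).

Lemma frame_matrix_coord T d z : tensor_field02 M T ->
  chart_dom (mchart d) (ss_psi z) ->
  frame_matrix lam T z = frame_coord_mx d z *m gram_coord T d (ss_psi z) *m
    (frame_coord_mx d z)^T.
Proof.
move=> [Tr Tl _] dz; apply: (gram_mulmx (Tr _) (Tl _)) => i.
apply: (tangent_eq dz); rewrite tcoord_linear.
rewrite [LHS]row_sum_delta; apply: eq_bigr => k _.
by rewrite mxE coord_vecE.
Qed.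

Lemma frame_matrix_smooth T : tensor_field02 M T ->
  smooth_fun (frame_matrix lam T).
Proof.
move=> TT c; apply: smooth_on_local => _ [z [cz _] <-].
(* It suffices to work on the part of the chart [c] sent by [ss_psi] into a single chart [d], where
   the factorisation [E G E^T] is available. *)
have [d dz] := mchart_cover (ss_psi z).
pose D := mchart c @` (chart_dom (mchart c) `&`
  ss_psi (s := lam) @^-1` chart_dom (mchart d)).
have oD : open D by exact/open_chart_image/open_psi_preimage.
exists D; first by exists z.
have DE : smooth_on D (frame_coord_mx d \o chart_inv (mchart c)).
  exact: frame_coord_mx_smooth.
have [[_ /(_ c d) Dpsi] _] := ss_psi_submersion lam.
apply: (@smooth_on_eq _ _ _ _ (fun x => let z := chart_inv (mchart c) x in
    frame_coord_mx d z *m gram_coord T d (ss_psi z) *m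
    (frame_coord_mx d z)^T)) => //.
  by move=> _ [z' [cz' dz'] <-]; rewrite /= chart_mapK// -frame_matrix_coord.
apply: smooth_on_mulmx => //; last exact: smooth_on_trmx.
apply: smooth_on_mulmx => //; apply/smooth_on_mxP => // i j.
have [_ _ /(_ d i j d)] := TT; rewrite setIid => Tij.
have := smooth_on_comp oD _ Dpsi Tij.
rewrite -/D => H; apply: (smooth_on_eq oD _ (H _)).
  by move=> _ [z' [cz' dz'] <-]; rewrite /= !mxE !chart_mapK.
by move=> _ [z' [cz' dz'] <-]; rewrite /= chart_mapK//; exists (ss_psi z').
Qed.

(** As [ss_psi] is surjective, every tangent space carries a frame, and a bilinear form is
    determined by its values on a basis. *)
Lemma frame_matrix_inj : set_inj (tensor_field02 M) (frame_matrix lam).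
Proof.
move=> T T'; rewrite !inE => -[Tr Tl _] [Tr' Tl' _] TT'.
apply/functional_extensionality_dep => p.
apply/funext => u; apply/funext => v.
have [z zp] := ss_psi_surj lam p; case: p / zp u v => u v.
have [_ /[dup] /(_ u)[a ->] /(_ v)[b ->]] := ss_e_basis z.
rewrite (scalar_sumZ _ _ _ (Tr _ _)) (scalar_sumZ _ _ _ (Tr' _ _)).
apply: eq_bigr => i _; congr (_ * _).
rewrite (scalar_sumZ _ _ _ (Tl _ _)) (scalar_sumZ _ _ _ (Tl' _ _)).
apply: eq_bigr => j _; congr (_ * _).
by have /(congr1 (fun F => F z j i)) := TT'; rewrite !mxE.
Qed.

(** * The tensor field of an equivariant matrix function *)

Section Descend.
Variables (F : ss_N lam -> 'M[R]_n) (Finv : equivariant F).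

Definition fiber_point (p : M) : ss_N lam := projT1 (cid (ss_psi_surj lam p)).

Lemma fiber_pointK p : ss_psi (fiber_point p) = p.
Proof. by rewrite /fiber_point; case: cid. Qed.

Definition some_frame_coords p (u : tangent p) : 'rV[R]_n :=
  projT1 (cid (frame_coords_exists u (fiber_pointK p))).

Lemma some_frame_coordsP p (u : tangent p) :
  frame_coords (fiber_point p) u (some_frame_coords u).
Proof. by rewrite /some_frame_coords; case: cid. Qed.

Definition descend (p : M) (u v : tangent p) : R :=
  (some_frame_coords u *m F (fiber_point p) *m (some_frame_coords v)^T) 0 0.

(** If [z] is the chosen fiber point moved by [g], coordinates [a] at [z] become [a *m (L g)^T] at
    the chosen point, and these factors absorb the [(L g)^T] and [L g] that the invariance of [F]
    produces. *)
Lemma descendE z p (u v : tangent p) a b : ss_psi z = p ->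
  frame_coords z u a -> frame_coords z v b ->
  descend u v = (a *m F z *m b^T) 0 0.
Proof.
move=> zp ua vb.
have /(ss_act_trans (s := lam))[g gE] : ss_psi (fiber_point p) = ss_psi z.
  by rewrite zp fiber_pointK.
have FE : F z = (L g)^T *m F (fiber_point p) *m L g.
  by rewrite gE; exact: (congr1 (@^~ (fiber_point p)) (Finv g)).
have coordE (w : tangent p) c : frame_coords z w c ->
    some_frame_coords w = c *m (L g)^T.
  move=> wc; apply: (frame_coords_uniq (fiber_pointK p)).
    exact: some_frame_coordsP.
  by move=> d; rewrite wc gE (frame_coord_mx_act hL) mulmxA.
by rewrite /descend FE (coordE _ _ ua) (coordE _ _ vb) trmx_mul trmxK !mulmxA.
Qed.

Lemma descend_scalarr p (u : tangent p) : scalar (descend u).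
Proof.
move=> k v w; have [ua va wa] := And3 (some_frame_coordsP u)
  (some_frame_coordsP v) (some_frame_coordsP w).
rewrite (descendE (fiber_pointK p) ua
  (b := k *: some_frame_coords v + some_frame_coords w)).
  by rewrite /descend linearP /= mulmxDr -scalemxAr !mxE.
by move=> d; rewrite mulmxDl -scalemxAl -va -wa.
Qed.

Lemma descend_scalarl p (w : tangent p) : scalar (fun u => descend u w).
Proof.
move=> k u v; have [ua va wa] := And3 (some_frame_coordsP u)
  (some_frame_coordsP v) (some_frame_coordsP w).
rewrite (descendE (fiber_pointK p)
  (a := k *: some_frame_coords u + some_frame_coords v) _ wa).
  by rewrite /descend !mulmxDl -!scalemxAl !mxE.
by move=> d; rewrite mulmxDl -scalemxAl -va -ua.
Qed.

Lemma frame_matrix_descend : frame_matrix lam descend = F.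
Proof.
apply/funext => z; apply/matrixP => i j; rewrite mxE.
rewrite (descendE erefl (frame_coords_frame z i) (frame_coords_frame z j)).
by rewrite trmx_delta -rowE -colE !mxE.
Qed.

(** The frame coordinates of the [k]-th coordinate field form row [k] of the inverse of
    [frame_coord_mx d z]. *)
Lemma descend_coord_field d z i j : chart_dom (mchart d) (ss_psi z) ->
  descend (coord_field d i (ss_psi z)) (coord_field d j (ss_psi z)) =
  (invmx (frame_coord_mx d z) *m F z *m (invmx (frame_coord_mx d z))^T) i j.
Proof.
move=> dz; have coordE k : frame_coords z (coord_field d k (ss_psi z))
    (delta_mx 0 k *m invmx (frame_coord_mx d z)).
  apply: (frame_coords_chart dz).
  by rewrite mulmxKV ?frame_coord_mx_unit// coord_vecE.
rewrite (descendE erefl (coordE i) (coordE j)) trmx_mul trmx_delta.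
by rewrite !mulmxA -colE -!mulmxA -rowE !mulmxA !mxE.
Qed.

Lemma descend_smooth d i j : smooth_fun F ->
  smooth_fun_on (W := R^o) (chart_dom (mchart d))
    (fun p => descend (coord_field d i p) (coord_field d j p)).
Proof.
move=> sF c; apply: smooth_on_local => _ [p [cp dp] <-].
have [z zp] := ss_psi_surj lam p; case: p / zp cp dp => cz dz.
have [e ez] := mchart_cover z.
have [[_ /(_ e c) De] sub] := ss_psi_submersion lam.
set f := _ \o _ in De.
(* Both charts of [M] matter: smoothness is read in [c], while the coordinate fields are those of
   [d]. *)
pose D := mchart e @` (chart_dom (mchart e) `&`
  ss_psi (s := lam) @^-1` (chart_dom (mchart c) `&` chart_dom (mchart d))).
have oD : open D.
  apply: open_chart_image; rewrite preimage_setI.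
  by apply: openI; exact: open_psi_preimage.
have Dz : D (mchart e z) by exists z.
have fz : f (mchart e z) = mchart c (ss_psi z) by rewrite /f /= chart_mapK.
rewrite -fz; apply: (smooth_descent oD Dz).
- by apply: smooth_on_subset De => _ [y [ey [cy _]] <-]; exists y.
(* A row [w] is turned into a tangent vector of [M], lifted by the submersion property, and the lift
   is read in the chart [e]. *)
- move=> w; have [v /(_ e c ez cz)] := sub z (coord_vec c w (ss_psi z)).
  by rewrite coord_vecE// => wE; exists (v e).
pose E x := invmx (frame_coord_mx d (chart_inv (mchart e) x)).
have DE : smooth_on D E.
  apply: smooth_on_invmx => //.
    by move=> _ [y [ey [_ dy]] <-]; rewrite chart_mapK// frame_coord_mx_unit.
  have := frame_coord_mx_smooth (lam := lam) d e; apply: smooth_on_subset.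
  by move=> _ [y [ey [_ dy]] <-]; exists y.
have DF : smooth_on D (F \o chart_inv (mchart e)).
  by have := sF e; apply: smooth_on_subset => _ [y [ey _] <-]; exists y.
have DG : smooth_on D
    (fun x => E x *m (F \o chart_inv (mchart e)) x *m (E x)^T).
  by apply: smooth_on_mulmx => //;
    [exact: smooth_on_mulmx|exact: smooth_on_trmx].
apply: (smooth_on_eq oD _ ((smooth_on_mxP _ oD).1 DG i j)).
move=> _ [y [ey [cy dy]] <-].
by rewrite /f /E /= !chart_mapK// descend_coord_field.
Qed.

Lemma descend_tensor_field : smooth_fun F -> tensor_field02 M descend.
Proof.
move=> sF; split=> [p u|p w|d i j].
- exact: descend_scalarr.
- exact: descend_scalarl.
- exact: descend_smooth.
Qed.

End Descend.
End Correspondence.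

Theorem proposition5 (R : realType) (n : nat) (M : manifold R n)
    (lam : s_space M) (L : ss_O lam -> 'M[R]_n)
    (hL : base_change_morphism lam L) :
  set_bij (tensor_field02 M)
    [set F : ss_N lam -> 'M[R]_n |
       smooth_fun F /\
       forall a : ss_O lam,
         F \o ss_R lam a = (fun z => (L a)^T *m F z *m L a)]
    (frame_matrix lam).
Proof.
split=> [T TT|T T' |F [sF Finv]].
- by split; [exact: frame_matrix_smooth|exact: frame_matrix_equivariant].
- exact: frame_matrix_inj.
- exists (descend F); first exact: (descend_tensor_field hL Finv sF).
  exact: (frame_matrix_descend hL Finv).
Qed.
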